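(* Let $n\ge 3$ and consider the $n$-stage binary linear feedback shift register with feedback function $F(x_1,\ldots,x_n)=x_{n-1}+x_n$ over $GF(2)$. Its state diagram has exactly two connected components: $G_1$, containing the loop at $\mathbf{0}^n$, and $G_2$, containing the $3$-cycle on the states $v_1=(0,1,1,0,1,1,\ldots)$, $v_2=(1,1,0,1,1,0,\ldots)$, $v_3=(1,0,1,1,0,1,\ldots)$ (first $n$ terms). Then $G_1\setminus[0]$ (the digraph obtained from $G_1$ by deleting the vertex $\mathbf{0}^n$ and all arcs incident to it) is a perfect binary directed tree of depth $n-3$, and $G_2\setminus[0,1,1]$ (obtained from $G_2$ by deleting $v_1,v_2,v_3$ and all arcs incident to them) consists of three perfect binary directed trees of depth $n-3$.
   Context: An $n$-stage feedback shift register with feedback function $F:GF(2)^n\to GF(2)$ maps a state $(a_1,\ldots,a_n)$ to its successor $(a_2,\ldots,a_n,F(a_1,\ldots,a_n))$; its state diagram is the directed graph on $GF(2)^n$ with an arc from each state to its successor. Deleting a vertex from a digraph removes it together with all arcs incident to it. A perfect binary directed tree of depth $k$ is a directed graph whose underlying undirected graph is a perfect binary tree of depth $k$ with respect to some root (every non-leaf vertex has exactly two children and all leaves are at distance $k$ from the root), so it has $2^{k+1}-1$ vertices; in the present setting arcs are oriented towards the root. *)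

(* Defs.v *)
From HB Require Import structures.
From mathcomp Require Import all_boot all_order all_algebra.

Set Implicit Arguments.
Unset Strict Implicit.
Unset Printing Implicit Defensive.

Import GRing.Theory.
Local Open Scope ring_scope.

Record digraph (T : finType) := Digraph {
  vertices : {set T};
  arcs : {set T * T};
  arcs_vertices : arcs \subset setX vertices vertices
}.

Section Digraph.
Variable T : finType.
Implicit Types (D : digraph T) (A S V : {set T}) (e : rel T).

Lemma induced_subproof D A :
  [set a in arcs D | (a.1 \in A) && (a.2 \in A)]
    \subset setX (vertices D :&: A) (vertices D :&: A).
Proof.
apply/subsetP => a; rewrite !inE => /and3P[aD a1 a2].
by have := subsetP (arcs_vertices D) a aD; rewrite inE a1 a2 !andbT.
Qed.

Definition induced D A : digraph T := Digraph (induced_subproof D A).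

Definition delete D S : digraph T := induced D (~: S).

(* Adjacency in the underlying undirected graph. *)
Definition adj D : rel T :=
  [rel x y | ((x, y) \in arcs D) || ((y, x) \in arcs D)].

(* The vertex sets of the (weakly) connected components. *)
Definition components D : {set {set T}} :=
  equivalence_partition (connect (adj D)) (vertices D).

(* For a symmetric relation e, a closed walk of size 2 only runs back and
   forth along an edge, so it is not a cycle. *)
Definition acyclic e : Prop :=
  irreflexive e /\ forall c : seq T, ucycle e c -> (size c <= 2)%N.

Definition is_tree V e : Prop :=
  [/\ V != set0, {in V &, forall x y, connect e x y} & acyclic e].

(* The least length of an e-walk from x to y; equal to #|T| if there is none,
   since shortest walks have fewer than #|T| edges. *)
Definition dist e (x y : T) : nat :=
  find (fun d => [exists p : d.-tuple T, path e x p && (last x p == y)])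
       (iota 0 #|T|).

Definition children e (r v : T) : {set T} :=
  [set w | e v w & dist e r w == (dist e r v).+1].

Definition perfect_binary_tree (k : nat) V e (r : T) : Prop :=
  [/\ is_tree V e,
      r \in V,
      {in V, forall v, children e r v != set0 -> #|children e r v| = 2%N}
    & {in V, forall v, children e r v = set0 -> dist e r v = k}].

(* Arcs are oriented towards the root. *)
Definition perfect_binary_directed_tree (k : nat) D : Prop :=
  exists r : T,
    perfect_binary_tree k (vertices D) (adj D) r /\
    forall u v, (u, v) \in arcs D -> u \in children (adj D) r v.

End Digraph.

(* Coordinates are numbered from 0: x_i is the entry of index i - 1. *)
Definition state (n : nat) := n.-tuple 'F_2.

(* The default value F a of nth is used exactly at the last index. *)
Definition successor n (F : state n -> 'F_2) (a : state n) : state n :=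
  [tuple nth (F a) a i.+1 | i < n].

Lemma state_diagram_subproof n (F : state n -> 'F_2) :
  [set a : state n * state n | a.2 == successor F a.1] \subset setX setT setT.
Proof. by apply/subsetP => a _; rewrite !inE. Qed.

Definition state_diagram n (F : state n -> 'F_2) : digraph (state n) :=
  Digraph (state_diagram_subproof F).

Definition feedback n (x : state n) : 'F_2 := x`_(n - 2) + x`_(n - 1).

Definition zero_state n : state n := [tuple 0 | i < n].

(* The first n terms of the periodic sequence w w w ... *)
Definition periodic_state n (w : seq 'F_2) : state n :=
  [tuple w`_(i %% size w) | i < n].

(* Main.v *)
(* Every state of the register either has two predecessors, differing in their
   first entry, or none, according to whether its last entry is the sum of the
   two entries before it.  Call i a defect of x if x_(i+2) <> x_i + x_(i+1):
   one step of the register moves all defects one place to the left, so after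
   n - 2 steps a state is defect-free, and the four defect-free states are the
   zero state and v1, v2, v3, which the register permutes.  Each of them has one
   further predecessor, and this is the root of a binary tree whose leaves are
   the states having a defect at the last place, that is the states which need
   all n - 2 steps. *)
Require Import Defs.
From HB Require Import structures.
From mathcomp Require Import all_boot all_order all_algebra.
From mathcomp Require Import zify.

Set Implicit Arguments.
Unset Strict Implicit.
Unset Printing Implicit Defensive.

Import GRing.Theory.

(** * Induced subdigraphs, components and distances *)

Lemma adjE (T : finType) (D : digraph T) x y :
  adj D x y = ((x, y) \in arcs D) || ((y, x) \in arcs D).
Proof. by []. Qed.

Lemma adj_sym (T : finType) (D : digraph T) : symmetric (adj D).
Proof. by move=> x y; rewrite !adjE orbC. Qed.

Lemma mem_induced (T : finType) (D : digraph T) A x :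
  (x \in vertices (induced D A)) = (x \in vertices D) && (x \in A).
Proof. by rewrite inE. Qed.

(** Hypothesis and conclusion have the same shape, so the lemma can be iterated: deleting vertices
    and then passing to a component are successive inductions. *)
Lemma functional_induced (T : finType) (D : digraph T) (f : T -> T) A :
    (forall u v, ((u, v) \in arcs D) =
       [&& u \in vertices D, v \in vertices D & v == f u]) ->
  forall u v, ((u, v) \in arcs (induced D A)) =
    [&& u \in vertices (induced D A), v \in vertices (induced D A) & v == f u].
Proof.
move=> arcsE u v; rewrite !inE arcsE /= -!andbA.
by do !bool_congr; rewrite andbC -!andbA; do !bool_congr.
Qed.

Lemma connect_induced (T : finType) (D : digraph T) A x y :
  connect (adj (induced D A)) x y -> connect (adj D) x y.
Proof.
apply: connect_sub => {x y} u v uv; apply: connect1; rewrite adjE.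
by case/orP: uv; rewrite inE => /andP[->]; rewrite ?orbT.
Qed.

(** The first hypothesis makes [g] constant along undirected walks, the second joins any two points
    of a fibre. It serves both for the whole state diagram and for [H2]. *)
Lemma components_fibres (T I : finType) (D : digraph T) (g : T -> I) :
    (forall u v, (u, v) \in arcs D -> g u = g v) ->
    {in vertices D &, forall x y, g x = g y -> connect (adj D) x y} ->
  components D = [set [set x in vertices D | g x == i] | i in g @: vertices D].
Proof.
move=> gD conD.
have conE x y : connect (adj D) x y -> g x = g y.
  case/connectP=> p + ->; elim: p x => //= a p IHp x /andP[xa /IHp <-].
  by case/orP: xa => /gD.
rewrite -imset_comp; apply: eq_in_imset => x xD; apply/setP => y; rewrite !inE.
apply: andb_id2l => yD.
by apply/idP/eqP => [/conE-> // | yx]; apply: conD.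
Qed.

(** Since [h] gains at most one per edge, no walk from [r] to [v] has fewer than [h v] edges, and
    [p] attains this bound. *)
Lemma dist_eq_height (T : finType) (e : rel T) (h : T -> nat) (r v : T) p :
    (forall x y, e x y -> (h y <= (h x).+1)) -> h r = 0 ->
    path e r p -> last r p = v -> size p = h v ->
  dist e r v = h v.
Proof.
move=> eh hr ep lp sp.
have hpath q x : path e x q -> (h (last x q) <= h x + size q).
  elim: q x => [|a q IHq] x /=; first by rewrite addn0.
  case/andP=> xa /IHq /leq_trans; apply.
  by rewrite addnS -addSn leq_add2r eh.
(* [dist] only searches below [#|T|]. Shortening [p] to a walk without repetition shows that [h v]
   lies in that range. *)
have hT : (h v < #|T|).
  move: lp; case/shortenP: ep => q eq uq _ lq.
  have := hpath _ _ eq; rewrite lq hr add0n => /leq_ltn_trans; apply.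
  by rewrite -[(size q).+1]/(size (r :: q)) -(card_uniqP uq) max_card.
rewrite /dist; set a := (X in find X _).
have av : a (h v).
  apply/existsP; rewrite -sp; exists (in_tuple p).
  by rewrite ep lp eqxx.
have hasa : has a (iota 0 #|T|).
  by apply/hasP; exists (h v); rewrite ?mem_iota.
have flt : find a (iota 0 #|T|) < #|T|.
  by move: hasa; rewrite has_find size_iota.
have := nth_find 0 hasa; rewrite nth_iota // add0n.
case/existsP=> q /andP[eq /eqP lq].
have := hpath _ _ eq; rewrite lq hr add0n size_tuple => hle.
apply/eqP; rewrite eqn_leq hle andbT leqNgt; apply/negP => /(before_find 0).
by rewrite nth_iota // add0n av.
Qed.

Lemma card_fibres (T I : finType) (V : {set T}) (g : T -> I) :
  #|[set [set x in V | g x == i] | i in g @: V]| = #|g @: V|.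
Proof.
apply: card_in_imset => _ j /imsetP[x xV ->] _ /setP/(_ x).
by rewrite !inE xV eqxx => /esym/eqP.
Qed.

(** * Trees formed by the arcs from [v] to [f v], with a height function *)

Section FunctionalTree.

Variables (T : finType) (D : digraph T) (f : T -> T) (h : T -> nat).
Variables (r : T) (k : nat).
Let V := vertices D.

Hypothesis rV : r \in V.
Hypothesis arcsE :
  forall u v, ((u, v) \in arcs D) = [&& u \in V, v \in V & v == f u].
Hypothesis hr : h r = 0.
Hypothesis frV : f r \notin V.
Hypothesis parentV : forall v, v \in V -> v != r -> f v \in V.
Hypothesis h_parent : forall v, v \in V -> v != r -> h v = (h (f v)).+1.
Hypothesis card_preim :
  forall v, v \in V -> #|[set u in V | f u == v]| = if h v == k then 0 else 2.

(** No arc leaves the root, because [f r] is outside [V]; so [h_parent] applies to the tail of every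
    arc. *)
Lemma arc_height u v : (u, v) \in arcs D -> h u = (h v).+1.
Proof.
rewrite arcsE => /and3P[uV vV /eqP vE]; rewrite vE in vV *.
by apply: h_parent => //; apply: contraNneq frV => <-.
Qed.

Lemma adj_le_parent x y : adj D x y -> (h y <= h x) -> y = f x.
Proof.
case/orP=> [|/arc_height->]; last by rewrite ltnn.
by rewrite arcsE => /and3P[_ _ /eqP].
Qed.

Lemma root_path v : v \in V ->
  exists p, [/\ path (adj D) r p, last r p = v & size p = h v].
Proof.
move: {2}(h v) (erefl (h v)) => d; elim: d v => [|d IHd] v hv vV.
  have [->|/(h_parent vV)] := eqVneq v r; last by rewrite hv.
  by exists [::]; rewrite hr.
have vr : v != r by apply: contra_eq_neq hv => ->; rewrite hr.
have fvV := parentV vV vr.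
have [|p [rp lp sp]] := IHd _ _ fvV.
  by have := h_parent vV vr; rewrite hv => -[].
exists (rcons p v); split; last by rewrite size_rcons sp -h_parent.
  by rewrite rcons_path rp lp adjE !arcsE vV fvV eqxx orbT.
by rewrite last_rcons.
Qed.

Lemma dist_root v : v \in V -> dist (adj D) r v = h v.
Proof.
case/root_path=> p [rp lp sp]; apply: dist_eq_height rp lp sp => // x y.
by case/orP=> /arc_height-> //; rewrite ltnW.
Qed.

(** The neighbours of [v] are its preimages, one level further from the root, and possibly [f v],
    which the distance condition excludes. *)
Lemma children_root v : v \in V ->
  children (adj D) r v = [set u in V | f u == v].
Proof.
move=> vV; apply/setP => u; rewrite [u \in children _ _ _]inE [RHS]inE.
apply/andP/andP => [[vu]|[uV /eqP fu]].
  have uV : u \in V by case/orP: vu; rewrite arcsE => /and3P[].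
  rewrite !dist_root // => /eqP hu; split=> //.
  case/orP: vu; last by rewrite arcsE eq_sym => /and3P[].
  by move/arc_height/eqP; rewrite hu ltn_eqF.
have uvD : (u, v) \in arcs D by rewrite arcsE uV vV fu eqxx.
by rewrite adjE uvD orbT !dist_root // (arc_height uvD).
Qed.

(* At a vertex of maximal height on a cycle, both neighbours are its parent. *)
Lemma functional_acyclic : acyclic (adj D).
Proof.
split=> [x|c].
  by rewrite adjE orbb; apply/negP => /arc_height/eqP; rewrite ltn_eqF.
case: c => // x0 c0; set c := x0 :: c0 => uc.
have [x xc xmax] : exists2 x, x \in c & forall y, y \in c -> (h y <= h x).
  have x0c : x0 \in c by rewrite mem_head.
  by case: (arg_maxnP h x0c) => x xc xmax; exists x.
have [i s cE] := rot_to xc.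
rewrite -(size_rot i) cE; move: uc; rewrite -(rot_ucycle i) cE.
have {}xmax y : y \in x :: s -> (h y <= h x) by rewrite -cE mem_rot => /xmax.
case: s xmax {cE} => // y s xmax /andP[/=].
rewrite rcons_path => /and3P[xy _ lx] /and3P[_ ys _].
have yE := adj_le_parent xy
  (xmax y (mem_behead (s := x :: y :: s) (mem_head y s))).
rewrite adj_sym in lx.
(* The last vertex of the cycle is the other neighbour of [x], hence also equal to [f x = y].
   Without repetition this forces [s] to be empty. *)
have := adj_le_parent lx (xmax _ (mem_behead (s := x :: y :: s) (mem_last y s))).
rewrite -yE; case: s ys {xmax lx} => //= z s.
by move/negP => ys lE; case: ys; rewrite -lE mem_last.
Qed.

Lemma functional_tree : perfect_binary_directed_tree k D.
Proof.
exists r; split; last first.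
  move=> u v uv; move: (uv); rewrite arcsE => /and3P[uV vV /eqP vE].
  by rewrite children_root // inE uV vE eqxx.
split=> // [|v vV|v vV].
- split; last exact: functional_acyclic.
    by apply/set0Pn; exists r.
  have conr v : v \in V -> connect (adj D) r v.
    by case/root_path=> p [rp lp _]; apply/connectP; exists p.
  move=> x y /conr rx /conr; apply: connect_trans.
  by rewrite (sym_connect_sym (@adj_sym _ D)).
- by rewrite -card_gt0 children_root // card_preim //; case: ifP.
- move/eqP; rewrite -cards_eq0 children_root // card_preim // dist_root //.
  by case: (h v =P k).
Qed.

End FunctionalTree.

(** * Trees of transient states attached to an invariant set [P] *)

Section TransientTrees.

Variables (T : finType) (f : T -> T) (P : {set T}) (m : nat).

Hypothesis fP : {in P, forall x, f x \in P}.
Hypothesis f_injP : {in P &, injective f}.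
Hypothesis iterP : forall x, iter m f x \in P.
Hypothesis m_gt0 : (0 < m).
Hypothesis card_fibre : forall x, #|[set u | f u == f x]| = 2.
Hypothesis codom_iter : forall x, iter m.-1 f x \in P -> x \in codom f.

Definition height x := ex_minn (ex_intro (fun j => iter j f x \in P) m (iterP x)).

(** The point where the orbit of [x] enters [P]. Unlike [iter m f x] in general, it does not change
    when [f] is applied outside [P], so it can label the trees. *)
Definition base x := iter (height x) f x.

Lemma iter_inP j x : x \in P -> iter j f x \in P.
Proof. by move=> xP; elim: j => //= j; apply: fP. Qed.

Lemma height_le x j : (height x <= j) = (iter j f x \in P).
Proof.
rewrite /height; case: ex_minnP => i xi imin.
by apply/idP/idP => [/subnK<-|/imin//]; rewrite iterD iter_inP.
Qed.

Lemma height_le_max x : (height x <= m).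
Proof. by rewrite height_le. Qed.

Lemma baseP x : base x \in P.
Proof. by rewrite -height_le. Qed.

Lemma height_eq0 x : (height x == 0) = (x \in P).
Proof. by rewrite -leqn0 height_le. Qed.

Lemma height_f x : x \notin P -> height x = (height (f x)).+1.
Proof.
rewrite -height_eq0 -lt0n => x_gt0; apply/eqP; rewrite eqn_leq.
rewrite height_le iterSr -height_le leqnn /= -(prednK x_gt0) ltnS height_le.
by rewrite -iterSr -height_le prednK.
Qed.

Lemma base_id x : x \in P -> base x = x.
Proof. by rewrite -height_eq0 /base => /eqP->. Qed.

Lemma base_f x : x \notin P -> base (f x) = base x.
Proof. by move=> xP; rewrite /base (height_f xP) iterSr. Qed.

(** A preimage of [v] lies outside [P] and is one step higher, which is impossible at height [m].
    Below height [m], [codom_iter] puts [v] in the image of [f], whose fibres have two elements. *)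
Lemma card_preim_height v : v \notin P ->
  #|[set u | f u == v]| = if height v == m then 0 else 2.
Proof.
move=> vP; case: eqP => [hv|/eqP hv].
  apply: eq_card0 => u; rewrite inE; apply/negbTE/eqP => fu.
  have uP : u \notin P by apply: contra vP => /fP; rewrite fu.
  by have := height_le_max u; rewrite height_f // fu hv ltnn.
have /codom_iter/codomP[x ->] : iter m.-1 f v \in P; last exact: card_fibre.
by rewrite -height_le -ltnS prednK // ltn_neqAle hv height_le_max.
Qed.

(** Being injective on the finite set [P], [f] permutes it. So one of the two preimages of [c] is in
    [P] and, by injectivity, the other is not; the latter is the root. *)
Lemma transient_root c : c \in P ->
  exists2 r, r \notin P & forall u, u \notin P -> (f u == c) = (u == r).
Proof.
move=> cP.
have fPE : f @: P = P.
  apply/eqP; rewrite eqEcard card_in_imset // leqnn andbT.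
  by apply/subsetP => _ /imsetP[x xP ->]; apply: fP.
have /imsetP[b bP cE] : c \in f @: P by rewrite fPE.
have : #|[set u | f u == c] :\ b| = 1.
  have := cardsD1 b [set u | f u == c]; rewrite cE card_fibre inE eqxx.
  by case.
move/eqP/cards1P=> [r /setP rE]; exists r.
  have := rE r; rewrite !inE eqxx => /andP[rb /eqP fr].
  apply: contra rb => rP; apply/eqP/f_injP => //; by rewrite fr.
move=> u uP; have := rE u; rewrite !inE => <-.
by case: (u =P b) => // ub; rewrite ub bP in uP.
Qed.

Lemma connect_base (D : digraph T) x :
    (forall u, u \in vertices D -> (u, f u) \in arcs D) ->
  x \in vertices D -> connect (adj D) x (base x).
Proof.
move=> fD xD; rewrite /base; elim: (height x) => //= j IHj.
have /fD uD : iter j f x \in vertices D.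
  elim: j {IHj} => //= j /fD /(subsetP (arcs_vertices D)).
  by rewrite inE => /andP[].
by apply: connect_trans IHj _; apply: connect1; rewrite adjE uD.
Qed.

Definition transient c := [set x | (x \notin P) && (base x == c)].

Lemma transient_tree (D : digraph T) c : c \in P ->
    vertices D = transient c ->
    (forall u v, ((u, v) \in arcs D) =
       [&& u \in vertices D, v \in vertices D & v == f u]) ->
  perfect_binary_directed_tree m.-1 D.
Proof.
move=> cP VE arcsE; have [r rP rE] := transient_root cP.
have fr : f r = c by apply/eqP; rewrite rE.
have baser : base r = c by rewrite -base_f // fr base_id.
have f_eq_c x : base x = c -> f x \in P -> x \notin P -> x = r.
  by move=> bx fxP xP; apply/eqP; rewrite -rE // -bx -base_f // base_id.
(* The root has height 1, as it enters [P] in one step; depth in the tree is therefore the height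
   minus one. *)
apply: (@functional_tree _ D f (fun x => (height x).-1) r) => //.
- by rewrite VE inE rP baser eqxx.
- rewrite height_f //= fr; apply/eqP; by rewrite height_eq0.
- by rewrite VE inE fr cP.
- move=> v; rewrite VE !inE => /andP[vP /eqP bv] vr.
  rewrite base_f // bv eqxx andbT; apply: contra vr => fvP.
  exact/eqP/f_eq_c.
- move=> v; rewrite VE !inE => /andP[vP /eqP bv] vr.
  rewrite height_f //= prednK // lt0n height_eq0; apply: contra vr => fvP.
  exact/eqP/f_eq_c.
move=> v; rewrite VE inE => /andP[vP /eqP bv].
have v_gt0 : (0 < height v) by rewrite lt0n height_eq0.
have -> : ((height v).-1 == m.-1) = (height v == m).
  by rewrite -eqSS !prednK.
(* Every preimage of [v] is itself outside [P] with the same base, so restricting to the vertices of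
   [D] loses none. *)
rewrite -card_preim_height //; apply: eq_card => u; rewrite !inE.
case: (f u =P v) => [fu|]; rewrite ?andbF ?andbT //.
have uP : u \notin P by apply: contra vP => /fP; rewrite fu.
by rewrite uP -base_f // fu bv eqxx.
Qed.

End TransientTrees.

(** * One step of the register and its defect-free states *)

Local Open Scope ring_scope.

Lemma F2_cases (a : 'F_2) : (a == 0) || (a == 1).
Proof. by case: a => [[|[|]]]. Qed.

Section Register.

Variable n : nat.
Hypothesis hn : (3 <= n)%N.
Implicit Types (x y u : state n) (i j : nat).

Notation f := (successor (@feedback n)).

Lemma state_ext x y : (forall i, (i < n)%N -> x`_i = y`_i) -> x = y.
Proof.
move=> xy; apply/val_inj/(@eq_from_nth _ 0); rewrite !size_tuple //.
Qed.

Lemma nth_state (F : 'I_n -> 'F_2) i (lt_in : (i < n)%N) :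
  (mktuple F)`_i = F (Ordinal lt_in).
Proof. by rewrite -[i]/(val (Ordinal lt_in)) nth_mktuple. Qed.

Lemma nth_successor F x i :
  (i < n)%N -> (successor F x)`_i = nth (F x) x i.+1.
Proof. by move=> lt_in; rewrite /successor (nth_state _ lt_in). Qed.

Lemma nth_step x i : (i.+1 < n)%N -> (f x)`_i = x`_i.+1.
Proof.
move=> lt_in; rewrite (nth_successor _ _ (ltnW lt_in)).
by apply: set_nth_default; rewrite size_tuple.
Qed.

Lemma nth_step_last x i : i.+3 = n -> (f x)`_i.+2 = x`_i.+1 + x`_i.+2.
Proof.
move=> iE; have lt_in : (i.+2 < n)%N by rewrite -iE.
(* Index [i.+3] is out of range, so [nth] returns its default, the feedback bit. *)
rewrite (nth_successor _ _ lt_in) nth_default; last by rewrite size_tuple iE.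
have -> : i.+2 = (n - 1)%N by lia.
by have -> : i.+1 = (n - 2)%N by lia.
Qed.

(** The step shifts out entry 0, and since [n >= 3] the feedback reads only entries of positive
    index. *)
Lemma step_eqP u x :
  reflect (forall i, (0 < i < n)%N -> u`_i = x`_i) (f u == f x).
Proof.
apply: (iffP eqP) => [fux [//|i] /andP[_ lt_in]|ux].
  by rewrite -!nth_step // fux.
apply: state_ext => i lt_in; have [lt_i1n|le_ni] := ltnP i.+1 n.
  by rewrite !nth_step ?ux.
case: i lt_in le_ni => [|[|i]] lt_in le_ni; try by lia.
have iE : i.+3 = n by lia.
by rewrite !nth_step_last ?ux //; lia.
Qed.

Lemma card_step_fibre x : #|[set u | f u == f x]| = 2.
Proof.
(* By [step_eqP] the fibre consists of the states obtained from [x] by choosing the first entry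
   freely. *)
pose g (a : 'F_2) : state n := [tuple if i == 0%N :> nat then a else x`_i | i < n].
have gE a i : (i < n)%N -> (g a)`_i = if i == 0%N then a else x`_i.
  by move=> lt_in; rewrite (nth_state _ lt_in).
have n_gt0 : (0 < n)%N by lia.
have g_inj : injective g.
  by move=> a b /(congr1 (fun y : state n => y`_0)); rewrite !gE.
transitivity #|g @: setT|; last by rewrite card_imset // cardsT card_Fp.
apply: eq_card => u; rewrite !inE; apply/step_eqP/imsetP => [ux|[a _ ->] [//|i]].
  exists u`_0 => //; apply: state_ext => i lt_in; rewrite gE //.
  by case: i lt_in => //= i lt_in; apply: ux.
by case/andP=> _ lt_in; rewrite gE.
Qed.

(** There is no defect at [i]. It holds vacuously when [i.+2] is out of range, so the shift
    identities below need no bound on [i]. *)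
Definition fib_at x i := (i.+2 < n)%N ==> (x`_i.+2 == x`_i + x`_i.+1).

Definition fib_states := [set x | [forall i : 'I_n, fib_at x i]].

Lemma fib_statesP x : reflect (forall i, fib_at x i) (x \in fib_states).
Proof.
rewrite inE; apply: (iffP forallP) => // fx i; apply/implyP => lt_in.
have lt_in' : (i < n)%N by lia.
by have /implyP/(_ lt_in) := fx (Ordinal lt_in').
Qed.

(** In the boundary case [i.+3 = n] both sides hold: the new last entry is the feedback sum, and the
    condition on the right is vacuous. *)
Lemma fib_at_step x i : fib_at (f x) i = fib_at x i.+1.
Proof.
rewrite /fib_at; case: (ltngtP i.+3 n) => [lt_in|lt_ni|iE].
- have lt_i1n := ltnW lt_in.
  by rewrite (nth_step x lt_in) (nth_step x lt_i1n) (nth_step x (ltnW lt_i1n)).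
- by [].
- by rewrite (nth_step_last _ iE) !nth_step ?eqxx -?iE.
Qed.

Lemma fib_at_iter x i j : fib_at (iter j f x) i = fib_at x (i + j).
Proof.
by elim: j i => [|j IHj] i; rewrite ?addn0 //= fib_at_step IHj addnS.
Qed.

Lemma fib_states_step : {in fib_states, forall x, f x \in fib_states}.
Proof.
by move=> x /fib_statesP fx; apply/fib_statesP => i; rewrite fib_at_step.
Qed.

Lemma fib_states_iter x : iter (n - 2) f x \in fib_states.
Proof.
apply/fib_statesP => i; rewrite fib_at_iter; apply/implyP => ?; lia.
Qed.

(** After [n - 3] steps, place 0 carries the condition from place [n - 3] of [x], namely that its
    last entry is the sum of the two before it. *)
Lemma codom_step x : iter (n - 2).-1 f x \in fib_states -> x \in codom f.
Proof.
move=> /fib_statesP/(_ 0%N); rewrite fib_at_iter add0n => /implyP fx.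
(* The preimage prepends an arbitrary bit, here 0, and drops the last entry, which the feedback
   restores. *)
pose u : state n := [tuple (0 :: x)`_i | i < n].
have uE i : (i.+1 < n)%N -> u`_i.+1 = x`_i.
  by move=> lt_in; rewrite (nth_state _ lt_in).
apply/codomP; exists u; apply: state_ext => i lt_in.
have [lt_i1n|le_ni] := ltnP i.+1 n; first by rewrite nth_step ?uE.
case: i lt_in le_ni => [|[|i]] lt_in le_ni; try by lia.
have iE : i.+3 = n by lia.
have iE' : (n - 2).-1 = i by lia.
by rewrite nth_step_last // !uE; [rewrite iE' in fx; apply/eqP/fx | lia | lia].
Qed.

Lemma fib_states_ext : {in fib_states &, forall x y,
  x`_0 = y`_0 -> x`_1 = y`_1 -> x = y}.
Proof.
move=> x y /fib_statesP fx /fib_statesP fy xy0 xy1; apply: state_ext => i.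
elim/ltn_ind: i => -[|[|i]] // IHi lt_in.
have /implyP/(_ lt_in)/eqP-> := fx i; have /implyP/(_ lt_in)/eqP-> := fy i.
by rewrite !IHi //; lia.
Qed.

(** A step forgets only entry 0, and the recurrence recovers it from entries 1 and 2. *)
Lemma step_inj_fib_states : {in fib_states &, injective f}.
Proof.
move=> x y xP yP /eqP/step_eqP xy.
apply: fib_states_ext => //; last by apply: xy; lia.
move: xP yP => /fib_statesP/(_ 0%N)/implyP/(_ hn)/eqP x2.
move=> /fib_statesP/(_ 0%N)/implyP/(_ hn)/eqP y2.
have := xy 2%N hn; rewrite x2 y2 (xy 1%N) ?(ltnW hn) //; exact: addIr.
Qed.

(** * Explicit form of the defect-free states *)

Let z := zero_state n.
Let v1 := periodic_state n [:: 0; 1; 1].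
Let v2 := periodic_state n [:: 1; 1; 0].
Let v3 := periodic_state n [:: 1; 0; 1].

Lemma nth_zero_state i : z`_i = 0.
Proof.
have [lt_in|le_ni] := ltnP i n; first by rewrite (nth_state _ lt_in).
by rewrite nth_default ?size_tuple.
Qed.

Lemma nth_periodic_state w i :
  (i < n)%N -> (periodic_state n w)`_i = w`_(i %% size w).
Proof. by move=> lt_in; rewrite (nth_state _ lt_in). Qed.

Lemma zero_fib_state : z \in fib_states.
Proof.
by apply/fib_statesP => i; rewrite /fib_at !nth_zero_state addr0 eqxx implybT.
Qed.

(** In characteristic 2 the condition on [w] says that its three entries sum to zero. This is
    invariant under rotation, so the recurrence holds at every residue modulo 3. *)
Lemma periodic_fib_state (w : seq 'F_2) : size w = 3 ->
  w`_2 = w`_0 + w`_1 -> periodic_state n w \in fib_states.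
Proof.
move=> sw w2; have wP j : (j < 3)%N -> w`_(j.+2 %% 3) = w`_j + w`_(j.+1 %% 3).
  have ww (a : 'F_2) : a + a = 0 by case/orP: (F2_cases a) => /eqP->; apply/eqP.
  case: j => [|[|[|//]]] _; first exact: w2.
    by rewrite -[RHS]/(w`_1 + w`_2) w2 addrCA ww addr0.
  by rewrite -[RHS]/(w`_2 + w`_0) w2 addrAC ww add0r.
apply/fib_statesP => i; apply/implyP => lt_in.
rewrite !nth_periodic_state ?sw; try by lia.
have -> : (i.+2 %% 3 = (i %% 3).+2 %% 3)%N by lia.
have -> : (i.+1 %% 3 = (i %% 3).+1 %% 3)%N by lia.
by rewrite wP ?ltn_mod.
Qed.

Lemma fib_state_periodic x (w : seq 'F_2) : x \in fib_states -> size w = 3 ->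
  w`_2 = w`_0 + w`_1 -> x`_0 = w`_0 -> x`_1 = w`_1 -> x = periodic_state n w.
Proof.
move=> xP sw w2 x0 x1; have n_gt0 : (0 < n)%N by lia.
apply: fib_states_ext => //; first exact: periodic_fib_state.
  by rewrite (nth_periodic_state _ n_gt0) sw.
by rewrite (nth_periodic_state _ (ltnW hn)) sw.
Qed.

Lemma fib_statesE : fib_states = [set z; v1; v2; v3].
Proof.
apply/setP => x; rewrite !in_setU !in_set1; apply/idP/idP; last first.
  rewrite -!orbA => /or4P[] /eqP->; first exact: zero_fib_state.
  - by apply: periodic_fib_state => //; apply/eqP.
  - by apply: periodic_fib_state => //; apply/eqP.
  by apply: periodic_fib_state => //; apply/eqP.
move=> xP.
have x_per w := @fib_state_periodic x w xP.
(* A defect-free state is determined by its first two entries: 00, 01, 10 and 11 give [z], [v1],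
   [v3] and [v2]. *)
case/orP: (F2_cases x`_0) (F2_cases x`_1) => /eqP x0 /orP[] /eqP x1.
- have -> : x = z; last by rewrite eqxx.
  by apply: fib_states_ext; rewrite ?zero_fib_state ?nth_zero_state.
- by rewrite (x_per [:: 0; 1; 1]) ?eqxx ?orbT //; apply/eqP.
- by rewrite (x_per [:: 1; 0; 1]) ?eqxx ?orbT //; apply/eqP.
by rewrite (x_per [:: 1; 1; 0]) ?eqxx ?orbT //; apply/eqP.
Qed.

Lemma step_zero : f z = z.
Proof.
apply: fib_states_ext; rewrite ?fib_states_step ?zero_fib_state //.
  by rewrite (nth_step _ (ltnW hn)) !nth_zero_state.
by rewrite (nth_step _ hn) !nth_zero_state.
Qed.

Lemma step_periodic (a b c : 'F_2) : c = a + b ->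
  f (periodic_state n [:: a; b; c]) = periodic_state n [:: b; c; a].
Proof.
move=> cE; have abcP : periodic_state n [:: a; b; c] \in fib_states.
  exact: periodic_fib_state.
apply: fib_state_periodic => //; first exact: fib_states_step.
- case/orP: (F2_cases b) cE => /eqP->; case/orP: (F2_cases a) => /eqP-> ->;
    exact/eqP.
- by rewrite (nth_step _ (ltnW hn)) (nth_periodic_state _ (ltnW hn)).
by rewrite (nth_step _ hn) (nth_periodic_state _ hn).
Qed.

Lemma zero_neq_periodic (w : seq 'F_2) : size w = 3 ->
  (w`_0 != 0) || (w`_1 != 0) -> z != periodic_state n w.
Proof.
move=> sw; apply: contraL => /eqP zE; have n_gt0 : (0 < n)%N by lia.
have := nth_periodic_state w n_gt0; rewrite -zE nth_zero_state sw => <-.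
have := nth_periodic_state w (ltnW hn); rewrite -zE nth_zero_state sw => <-.
by rewrite eqxx.
Qed.

Lemma uniq_periodic : uniq [:: v1; v2; v3].
Proof.
have n_gt0 : (0 < n)%N by lia.
have neq i (lt_in : (i < n)%N) w w' : w`_(i %% size w) != w'`_(i %% size w') ->
    periodic_state n w != periodic_state n w'.
  by apply: contraNneq => ww'; rewrite -!nth_periodic_state // ww'.
have v12 : v1 != v2 by apply: (neq _ n_gt0).
have v13 : v1 != v3 by apply: (neq _ n_gt0).
have v23 : v2 != v3 by apply: (neq _ (ltnW hn)).
by rewrite /= !inE negb_or v12 v13 v23.
Qed.

End Register.

(** * The two components and their trees *)

Theorem theorem4 (n : nat) (hn : (3 <= n)%N) :
  let D := state_diagram (@feedback n) in
  let z := zero_state n in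
  let v1 := periodic_state n [:: 0; 1; 1] in
  let v2 := periodic_state n [:: 1; 1; 0] in
  let v3 := periodic_state n [:: 1; 0; 1] in
  exists C1 C2 : {set state n},
    let G1 := induced D C1 in
    let G2 := induced D C2 in
    let H1 := delete G1 [set z] in
    let H2 := delete G2 [set v1; v2; v3] in
    [/\ C1 != C2 /\ components D = [set C1; C2],
        (z, z) \in arcs G1,
        uniq [:: v1; v2; v3] /\
          [/\ (v1, v2) \in arcs G2, (v2, v3) \in arcs G2
            & (v3, v1) \in arcs G2],
        perfect_binary_directed_tree (n - 3) H1
      & #|components H2| = 3%N /\
        {in components H2, forall C : {set state n},
           perfect_binary_directed_tree (n - 3) (induced H2 C)}].
Proof.
move=> D z v1 v2 v3.
set f := successor (@feedback n).
pose P := fib_states n.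
have PE : P = [set z; v1; v2; v3] by apply: fib_statesE.
have fP : {in P, forall x, f x \in P} by apply: fib_states_step.
have f_inj : {in P &, injective f} by apply: step_inj_fib_states.
have iterP : forall x, iter (n - 2) f x \in P by apply: fib_states_iter.
have m_gt0 : (0 < n - 2)%N by lia.
have m_pred : (n - 2).-1 = (n - 3)%N by lia.
pose b := base iterP.
have b_id x : x \in P -> b x = x by apply: base_id.
have b_f x : x \notin P -> b (f x) = b x by apply: base_f.
have bP x : b x \in P by apply: baseP.
have arcD u v : ((u, v) \in arcs D) = (v == f u) by rewrite inE.
have fz : f z = z by apply: step_zero.
have fv1 : f v1 = v2 by apply: step_periodic => //; apply/eqP.
have fv2 : f v2 = v3 by apply: step_periodic => //; apply/eqP.
have fv3 : f v3 = v1 by apply: step_periodic => //; apply/eqP.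
have uv : uniq [:: v1; v2; v3] by apply: uniq_periodic.
have zv1 : z != v1 by apply: zero_neq_periodic.
have zv2 : z != v2 by apply: zero_neq_periodic.
have zv3 : z != v3 by apply: zero_neq_periodic.
have [zP v1P v2P v3P] : [/\ z \in P, v1 \in P, v2 \in P & v3 \in P].
  by rewrite PE !inE !eqxx !orbT.
(* Inside [P] the map [f] moves the base around the 3-cycle, but whether the base is [z] is
   preserved, as [f] fixes [z] and is injective on [P]. This invariant separates the two
   components. *)
have bz_f x : (b (f x) == z) = (b x == z).
  have [xP|/b_f-> //] := boolP (x \in P).
  by rewrite !b_id ?fP // -[in LHS]fz (inj_in_eq f_inj).
pose C1 := [set x | b x == z]; pose C2 := [set x | b x != z].
have tree H c : c \in P -> vertices H = transient iterP c ->
    (forall u v, ((u, v) \in arcs H) =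
      [&& u \in vertices H, v \in vertices H & v == f u]) ->
    perfect_binary_directed_tree (n - 3) H.
  rewrite -m_pred; apply: transient_tree => //.
    exact: card_step_fibre.
  exact: codom_step.
have arcsDE u v : ((u, v) \in arcs D) =
    [&& u \in vertices D, v \in vertices D & v == f u].
  by rewrite arcD !in_setT.
exists C1, C2 => G1 G2 H1 H2.
have arcG C u v : ((u, v) \in arcs (induced D C)) =
    [&& v == f u, u \in C & v \in C] by rewrite inE arcD.
have zC1 : z \in C1 by rewrite inE b_id.
have C2P v : v \in P -> (v \in C2) = (v != z) by move=> vP; rewrite inE b_id.
have arcsH1E := functional_induced (~: [set z]) (functional_induced C1 arcsDE).
have arcsH2E := functional_induced (~: [set v1; v2; v3])
  (functional_induced C2 arcsDE).
(* [C2] already omits [z], so deleting the 3-cycle removes all that is left of [P]. *)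
have VH2 x : (x \in vertices H2) = (x \notin P) && (b x != z).
  have -> : (x \in vertices H2) = (x \in C2) && (x \notin [set v1; v2; v3]).
    by rewrite !inE.
  have xPE : (x \in P) = (x == z) || (x \in [set v1; v2; v3]).
    by rewrite PE !in_setU !in_set1 !orbA.
  have [xP|xP] := boolP (x \in P); last first.
    by move: xP; rewrite xPE negb_or => /andP[_ ->]; rewrite andbT inE.
  by move: (xP); rewrite C2P // xPE; case: (x == z) => //= ->.
pose F c := [set x in vertices H2 | b x == c].
have mem_F c x : (x \in F c) = (x \in vertices H2) && (b x == c).
  by rewrite [LHS]in_set.
have treeH2 c : c \in P -> c != z ->
    perfect_binary_directed_tree (n - 3) (induced H2 (F c)).
  move=> cP cz; apply: (tree _ c) => //; last exact: functional_induced.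
  apply/setP=> x; rewrite [RHS]inE -/(b x).
  rewrite mem_induced mem_F andbA andbb VH2.
  by case: (b x =P c) => [->|]; rewrite ?andbF // cz !andbT.
have compH2 : components H2 = [set F c | c in b @: vertices H2].
  apply: components_fibres => [u v|x y xH yH bxy].
    rewrite arcsH2E => /and3P[]; rewrite VH2 => /andP[uP _] _ /eqP->.
    by rewrite b_f.
  have bxz : b x != z by move: xH; rewrite VH2 => /andP[].
  (* Connectedness of a fibre of [b] is read off from its being a tree. *)
  have [r [[[_ + _] _ _ _] _]] := treeH2 _ (bP x) bxz.
  move/(_ x y) => con; apply: connect_induced; apply: con.
    by rewrite mem_induced mem_F xH eqxx.
  by rewrite mem_induced mem_F yH bxy eqxx.
have imH2 : b @: vertices H2 = [set v1; v2; v3].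
  apply/setP => c.
  have -> : (c \in [set v1; v2; v3]) = (c \in P) && (c != z).
    rewrite PE !in_setU !in_set1; have [->|] := eqVneq c z; last by rewrite andbT.
    by rewrite (negPf zv1) (negPf zv2) (negPf zv3).
  apply/imsetP/andP => [[x + ->]|[cP cz]].
    by rewrite VH2 => /andP[].
  (* The root of the tree at [c] witnesses that [c] is attained as a base. *)
  have [r [[_ + _ _] _]] := treeH2 c cP cz.
  by rewrite mem_induced mem_F => /and3P[rH _ /eqP <-]; exists r.
split.
- split.
    by apply/eqP => /setP/(_ z); rewrite zC1 C2P // eqxx.
  have conb x : connect (adj D) x (b x).
    by apply: connect_base => [u _|]; rewrite ?arcD ?in_setT.
  (* With [conb], which joins each state to its base, this connects all states of [C2] through the
     3-cycle. *)
  have conv x : x \in P -> x != z -> connect (adj D) v1 x.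
    have arc u v : v = f u -> connect (adj D) u v.
      by move=> vE; apply: connect1; rewrite adjE arcD vE eqxx.
    rewrite PE !in_setU !in_set1 => + /negPf xz; rewrite xz -orbA.
    case/or3P => /eqP->; [exact: connect0 | exact: arc |].
    by apply: connect_trans (arc _ _ (esym fv1)) _; apply: arc.
  have symD : connect_sym (adj D) := sym_connect_sym (@adj_sym _ D).
  rewrite (@components_fibres _ _ D (fun x => b x == z)).
  - have -> : (fun x => b x == z) @: vertices D = [set true; false].
      apply/setP => -[]; rewrite !inE; apply/imsetP; [exists z | exists v1] => //.
        by rewrite b_id ?eqxx.
      by rewrite b_id // eq_sym (negPf zv1).
    rewrite imsetU1 imset_set1; congr [set _; _]; apply/setP => x; rewrite !inE.
      by rewrite eqb_id.
    by rewrite eqbF_neg.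
  - by move=> u v; rewrite arcD => /eqP->; rewrite bz_f.
  move=> x y _ _ bxy; apply: connect_trans (conb x) _.
  rewrite symD; apply: connect_trans (conb y) _; rewrite symD.
  have [bx|bx] := eqVneq (b x) z.
    by move: bxy; rewrite bx eqxx => /esym/eqP->; apply: connect0.
  have by_z : b y != z by rewrite -bxy.
  by apply: connect_trans (conv _ (bP y) by_z); rewrite symD conv.
- by rewrite arcG fz eqxx zC1.
- split=> //; rewrite !arcG fv1 fv2 fv3 !C2P // !eqxx.
  by rewrite ![_ == z]eq_sym zv1 zv2 zv3.
- apply: (tree _ z) => //.
  apply/setP=> x; rewrite [RHS]inE -/(b x).
  have -> : (x \in vertices H1) = (x != z) && (b x == z).
    by rewrite !inE andbC.
  (* Among the states of [P] only [z] has base [z], so deleting [z] leaves just the transient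
     states. *)
  have [xP|xP] := boolP (x \in P); first by rewrite b_id //; case: (x =P z).
  by have -> : x != z by apply: contraNneq xP => ->.
split.
  rewrite compH2 card_fibres imH2.
  rewrite -[3%N]/(size [:: v1; v2; v3]) -(card_uniqP uv).
  by apply: eq_card => x; rewrite !inE orbA.
move=> C; rewrite compH2 => /imsetP[_ /imsetP[x + ->] ->].
by rewrite VH2 => /andP[_ bz]; apply: treeH2.
Qed.
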